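(* Let $(X,d)$ be a complete metric space and let $\mathcal{I}=\{X;f_1,\dots,f_N\}$ be an IFS of contracting similarities with coding map $\Theta$. Let $E\subseteq X$ be a sub-self-similar set for $\mathcal{I}$, and let $S\subseteq I^\infty$ be a compact set closed under left shift such that $\Theta(S)=E$. Let $C\subset X$ be a non-empty compact set and define $$O_S := C\cup\bigcup_{\omega\in S^*} f_\omega(C).$$ Then $E\cup O_S$ is an inhomogeneous sub-self-similar set corresponding to $\mathcal{I}$ with condensation set $C$; that is, $E\cup O_S$ is non-empty, compact, and $$E\cup O_S\subseteq \bigcup_{i=1}^N f_i(E\cup O_S)\cup C.$$
   Context: Each $f_i:X\to X$ is a similarity with ratio $\rho_i\in(0,1)$. A non-empty compact set $E\subseteq X$ is a sub-self-similar (SSS) set for $\mathcal{I}$ if $E\subseteq\bigcup_{i=1}^N f_i(E)$. For a compact set $C\subseteq X$ (the condensation set), a non-empty compact set $F_C\subseteq X$ is an inhomogeneous sub-self-similar (ISSS) set for $\mathcal{I}$ with condensation set $C$ if $F_C\subseteq\bigcup_{i=1}^N f_i(F_C)\cup C$. Code space: $I=\{1,\dots,N\}$ and $I^\infty$ is the set of infinite sequences $\omega=\omega_1\omega_2\cdots$ in $I$ with the (compact) product topology. For a finite word $\omega=\omega_1\cdots\omega_n$ put $f_\omega=f_{\omega_1}\circ\cdots\circ f_{\omega_n}$. The coding map is $\Theta(\omega)=\lim_{n\to\infty}f_{\omega_1}\circ\cdots\circ f_{\omega_n}(x)$ for $\omega\in I^\infty$ (independent of $x\in X$). A compact $S\subseteq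 I^\infty$ is closed under left shift if $\omega_1\omega_2\omega_3\cdots\in S$ implies $\omega_2\omega_3\cdots\in S$. For $n\ge1$, $S^n=\{\omega_1\cdots\omega_n:\omega\in S\}$ and $S^*=\bigcup_{n\ge1}S^n$. *)

(* Defs.v *)
From HB Require Import structures.
From mathcomp Require Import all_boot all_order all_algebra.
From mathcomp Require Import all_classical all_reals all_analysis.

Set Implicit Arguments.
Unset Strict Implicit.
Unset Printing Implicit Defensive.

Import Order.TTheory GRing.Theory Num.Theory.

Local Open Scope classical_set_scope.
Local Open Scope ring_scope.

(* The library's [Complete] includes a base point; every space carrying a
   sub-self-similar set is non-empty, so this excludes nothing of interest. *)
#[short(type="completeMetricType")]
HB.structure Definition CompleteMetric (K : numDomainType) :=
  {T of Metric K T & Complete T}.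

Definition similarity (R : realType) (X : metricType R) (r : R) (g : X -> X) :=
  forall x y : X, mdist (g x) (g y) = r * mdist x y.

Definition similarity_IFS (R : realType) (X : metricType R) (N : nat)
    (rho : 'I_N -> R) (f : 'I_N -> X -> X) :=
  forall i : 'I_N, 0 < rho i < 1 /\ similarity (rho i) (f i).

Definition SSS (X : topologicalType) (N : nat) (f : 'I_N -> X -> X)
    (E : set X) :=
  [/\ E !=set0, compact E & E `<=` \bigcup_(i : 'I_N) (f i @` E)].

Definition ISSS (X : topologicalType) (N : nat) (f : 'I_N -> X -> X)
    (C F : set X) :=
  [/\ F !=set0, compact F & F `<=` (\bigcup_(i : 'I_N) (f i @` F)) `|` C].

(* Symbols and positions are numbered from 0: the letter [w n] is the
   mathematical omega_(n+1). *)
Definition code_space (N : nat) : topologicalType :=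
  {ptws nat -> discrete_topology 'I_N}.

Definition shift (N : nat) (w : code_space N) : code_space N :=
  fun n => w n.+1.

Definition shift_closed (N : nat) (S : set (code_space N)) :=
  forall w, S w -> S (shift w).

Definition code_prefix (N : nat) (n : nat) (w : code_space N) : seq 'I_N :=
  mkseq w n.

Definition prefixes (N : nat) (S : set (code_space N)) : set (seq 'I_N) :=
  \bigcup_(n in [set n : nat | (1 <= n)%N]) (code_prefix n @` S).

Definition word_map (X : Type) (N : nat) (f : 'I_N -> X -> X)
    (s : seq 'I_N) : X -> X :=
  foldr (fun i g => f i \o g) id s.

(* For a family of contractions the limit exists and does not depend on [x]. *)
Definition coding_map (R : realType) (X : completeMetricType R) (N : nat)
    (f : 'I_N -> X -> X) (x : X) (w : code_space N) : X :=
  lim (word_map f (code_prefix n w) x @[n --> \oo]).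

Definition orbital_set (X : Type) (N : nat) (f : 'I_N -> X -> X)
    (C : set X) (S : set (code_space N)) : set X :=
  C `|` \bigcup_(s in prefixes S) (word_map f s @` C).

(* Main.v *)
(* With r < 1 a common bound on the ratios, the orbit of x under all the maps
   f_s is bounded, so f_(w|n)(C) lies within a constant times r^n of the point
   Theta(w) of E, uniformly in w in S. Hence every neighbourhood of E contains
   all the levels of the orbital set but finitely many. Each level is a finite
   union of continuous images of C, so adding them to E keeps it compact. *)
Require Import Defs.
From mathcomp Require Import all_boot all_order all_algebra.
From mathcomp Require Import all_classical all_reals all_analysis.
From mathcomp Require Import ring.

Import Order.TTheory GRing.Theory Num.Theory.

Set Implicit Arguments.
Unset Strict Implicit.

Local Open Scope classical_set_scope.
Local Open Scope ring_scope.

(** Compactness is used in its near-covering form. Compactness of [E] makes the property [P] hold on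
    a whole [e]-neighbourhood of [E] for one [e]; the levels from some [m] on lie in it, and the
    earlier ones form a finite union of compact sets. *)
Lemma compact_setU_bigcup_shrinking (R : realType) (X : metricType R)
    (E : set X) (L : nat -> set X) :
  compact E -> (forall n, compact (L n)) ->
  (forall e : R, 0 < e ->
    \forall n \near \oo, forall y, L n y -> exists2 x, E x & ball x e y) ->
  compact (E `|` \bigcup_n L n).
Proof.
move=> /compact_near_coveringP cE cL LE; apply/compact_near_coveringP.
move=> I F P FF cov.
(* The radius joins the index: pairs [(i, t)] with [t] tending to 0 from the right, the property at
   [y] being that [P i] holds on the ball of radius [t] about [y]. *)
have [] := cE (I * R)%type (filter_prod F (0^'+))
  (fun p y => forall z, ball y p.2 z -> P p.1 z) _.
  move=> y Ey; have [|[A B] /= [yA FB] AB] := cov y; first by left.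
  have /nbhs_ballP[e /= e0 eA] := yA.
  exists (ball y (e / 2), [set p : I * R | B p.1 /\ p.2 < e / 2]) => /=.
    split; first by apply: nbhsx_ballx; rewrite divr_gt0.
    exists (B, [set t | t < e / 2]) => //=; split => //.
    by apply: nbhs_right_lt; rewrite divr_gt0.
  move=> [z [i t]] /= [yz [Bi te]] u zu; apply: (AB (u, i)); split => //=.
  apply: eA; rewrite (splitr e); apply: ball_triangle yz _.
  exact: le_ball (ltW te) _ zu.
move=> [A B] /= [FA B0] AB.
have [e [e0 Be]] : exists e : R, 0 < e /\ B e.
  have : \forall e \near 0^'+, 0 < e /\ B e.
    by apply: filterI => //; exact: nbhs_right_gt.
  by move=> /(@filter_ex _ _ _) [e]; exists e.
have [m _ Lm] := LE e e0.
have cLm : compact (\big[setU/set0]_(k < m) L k).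
  exact: bigsetU_compact.
move/compact_near_coveringP/(_ I F P FF) : cLm; rewrite -bigcup_mkord => covL.
have {}covL : \near F, \bigcup_(k in `I_m) L k `<=` P F.
  by apply: covL => y [k _ Lky]; apply: cov; right; exists k.
apply: filterS2 FA covL => i Ai iL y [Ey|[k _ Lky]].
  by apply: (AB (i, e) (conj Ai Be) y Ey); exact: ballxx.
have [km|mk] := ltnP k m; first by apply: iL; exists k.
have [z Ez zy] := Lm k mk y Lky.
exact: (AB (i, e) (conj Ai Be) z Ez).
Qed.

Lemma compact_mdist_bounded (R : realType) (X : metricType R) (x : X)
    (K : set X) :
  compact K -> exists2 M : R, 0 <= M & forall y, K y -> mdist x y <= M.
Proof.
move=> /compact_near_coveringP /(_ R (+oo%R) (fun M y => mdist x y <= M)).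
case=> [y _|M [_ KM]]; last first.
  (* The filter at infinity gives the bound only for values strictly above [M], hence [M + 1]. *)
  exists (Num.max 0 (M + 1)); first by rewrite le_max lexx.
  move=> y; apply: (KM _ _ y).
  by rewrite lt_max ltrDl ltr01 orbT.
exists (ball y 1, [set M | mdist x y + 1 < M]) => /=.
  split; first exact: nbhsx_ballx.
  by exists (mdist x y + 1); split; rewrite ?num_real.
move=> [z M] /= []; rewrite ballEmdist /= => yz /ltW; apply: le_trans.
by rewrite (le_trans (metric_triangle x y z))// lerD2l ltW.
Qed.

Lemma similarity_continuous (R : realType) (X : metricType R) (r : R)
    (g : X -> X) : 0 < r -> similarity r g -> continuous g.
Proof.
move=> r0 simg y; apply/metricType_numDomainType.cvgrPdist_lt => e e0.
near=> z; rewrite simg -ltr_pdivlMl// mulrC.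
near: z; apply: metricType_numDomainType.cvgr_dist_lt; first exact: cvg_id.
by rewrite divr_gt0.
Unshelve. all: by end_near. Qed.

Section Words.
Context (R : realType) (X : metricType R) (N : nat) (rho : 'I_N -> R).
Variable f : 'I_N -> X -> X.
Hypothesis f_sim : similarity_IFS rho f.

Lemma IFS_ratio_bound : exists2 r : R, 0 <= r < 1 & forall i, rho i <= r.
Proof.
(* The starting value 0 makes the maximum meaningful for [N = 0] too. *)
exists (\big[Num.max/0]_i rho i); last by move=> i; exact: le_bigmax.
apply/andP; split; first exact: bigmax_ge_id.
by apply: bigmax_lt => // i _; have [/andP[]] := f_sim i.
Qed.

Lemma word_map_cat s t : word_map f (s ++ t) = word_map f s \o word_map f t.
Proof. by elim: s => //= i s ->. Qed.

Lemma word_map_continuous s : continuous (word_map f s).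
Proof.
elim: s => [|i s IHs] y; first exact: cvg_id.
have [/andP[rho0 _] simi] := f_sim i.
by apply: continuous_comp; [exact: IHs|exact: similarity_continuous simi _].
Qed.

Variable r : R.
Hypotheses (r_itv : 0 <= r < 1) (rho_r : forall i, rho i <= r).

Lemma word_map_lipschitz s y z :
  mdist (word_map f s y) (word_map f s z) <= r ^+ size s * mdist y z.
Proof.
have /andP[r0 _] := r_itv.
elim: s => [|i s IHs] /=; first by rewrite expr0 mul1r.
have [/andP[/ltW rho0 _] ->] := f_sim i.
by rewrite exprS -mulrA ler_pM// mdist_ge0.
Qed.

(** If [D] is the largest displacement of [x] under a single map, prefixing a letter turns a bound
    [b] into [D + r * b]; the value [D / (1 - r)] is the fixed point of this recursion. *)
Lemma word_map_orbit_bounded x :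
  exists2 B : R, 0 <= B & forall s, mdist x (word_map f s x) <= B.
Proof.
have /andP[r0 r1] := r_itv.
pose D := \big[Num.max/0]_i mdist x (f i x).
have D0 : 0 <= D by exact: bigmax_ge_id.
have r1' : 0 < 1 - r by rewrite subr_gt0.
exists (D / (1 - r)); first by rewrite divr_ge0// ltW.
elim=> [|i s IHs] /=; first by rewrite mdistxx divr_ge0// ltW.
apply: (le_trans (metric_triangle _ (f i x) _)).
have -> : D / (1 - r) = D + r * (D / (1 - r)).
  by field; rewrite lt0r_neq0.
have [/andP[/ltW rho0 _] ->] := f_sim i.
by rewrite lerD ?ler_pM ?mdist_ge0//; exact: (le_bigmax _ (fun i => mdist x (f i x))).
Qed.

Lemma code_prefix_cat n m (w : code_space N) :
  (n <= m)%N -> exists t, code_prefix m w = code_prefix n w ++ t.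
Proof.
move=> nm; exists (map w (iota n (m - n))).
by rewrite /code_prefix /mkseq -map_cat -[n in iota n]add0n -iotaD subnKC.
Qed.

(** The longer prefix is the shorter one followed by a word [t], so the map of the shorter one
    contracts the distance from [x] to its image under [t], which the orbit bound controls uniformly
    in [w]. *)
Lemma word_map_prefix_dist x : exists2 B : R, 0 <= B &
  forall w n m, (n <= m)%N ->
    mdist (word_map f (code_prefix n w) x) (word_map f (code_prefix m w) x)
      <= r ^+ n * B.
Proof.
have /andP[r0 _] := r_itv.
have [B B0 xB] := word_map_orbit_bounded x; exists B => // w n m nm.
have [t ->] := code_prefix_cat w nm; rewrite word_map_cat /=.
rewrite (le_trans (word_map_lipschitz _ _ _))// size_mkseq.
by rewrite ler_wpM2l ?exprn_ge0.
Qed.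

Lemma geometric_lt_near (a e : R) :
  0 < e -> \forall n \near \oo, r ^+ n * a < e.
Proof.
move=> e0; have /andP[r0 r1] := r_itv.
have /cvgrPdist_lt/(_ e e0) : geometric a r n @[n --> \oo] --> 0.
  by apply: cvg_geometric; rewrite ger0_norm.
apply: filterS => n /=; rewrite sub0r normrN mulrC.
by apply: le_lt_trans; rewrite ler_norm.
Qed.

Lemma compact_words_image (C : set X) (S : set (code_space N)) n :
  compact C -> compact (\bigcup_(s in code_prefix n @` S) (word_map f s @` C)).
Proof.
move=> cC.
have fin_words : finite_set (code_prefix n @` S).
  (* Even for infinite [S], the prefixes of length [n] are among the finitely many [n]-tuples of
     letters. *)
  apply: (@sub_finite_set _ _ (@tval n 'I_N @` setT)) => [_ [w _ <-]|].
    by exists (Tuple (introT eqP (size_mkseq w n))).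
  by apply: finite_image; exact: finite_finset.
rewrite -bigsetU_fset_set//.
apply: bigsetU_compact => t _; apply: continuous_compact => //.
by apply: continuous_subspaceT; exact: word_map_continuous.
Qed.

End Words.

(** The uniform prefix estimate makes the sequence Cauchy, so by completeness the [lim] is a true
    limit; letting the longer prefix grow in the same estimate bounds the distance to it. *)
Lemma coding_map_dist (R : realType) (X : completeMetricType R) (N : nat)
    (rho : 'I_N -> R) (f : 'I_N -> X -> X) (x : X) (r : R) :
  similarity_IFS rho f -> 0 <= r < 1 -> (forall i, rho i <= r) ->
  exists B : R, forall w n,
    mdist (coding_map f x w) (word_map f (code_prefix n w) x) <= r ^+ n * B.
Proof.
move=> f_sim r_itv rho_r.
have [B B0 fB] := word_map_prefix_dist f_sim r_itv rho_r x.
exists B => w n.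
have cvgw : cvg (word_map f (code_prefix n w) x @[n --> \oo]).
  apply: cauchy_cvg; apply: cauchy_exP => e e0.
  near \oo => k; exists (word_map f (code_prefix k w) x).
  change (\forall m \near \oo, ball (word_map f (code_prefix k w) x) e
    (word_map f (code_prefix m w) x)).
  near=> m; rewrite ballEmdist /=.
  apply: (@le_lt_trans _ _ (r ^+ k * B)).
    by apply: fB; near: m; exact: nbhs_infty_ge.
  by near: k; exact: geometric_lt_near.
apply/ler_addgt0Pr => e e0; near \oo => m.
rewrite (le_trans (metric_triangle _ (word_map f (code_prefix m w) x) _))//.
rewrite addrC lerD//.
  rewrite metric_sym; apply: fB; near: m; exact: nbhs_infty_ge.
near: m; exact: metricType_numDomainType.cvgr_dist_le.
Unshelve. all: by end_near. Qed.

(** [C] becomes level 0, given by the empty word; that word is a prefix of an element of [S] only if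
    [S] has an element. *)
Lemma orbital_setE (X : Type) (N : nat) (f : 'I_N -> X -> X) (C : set X)
    (S : set (code_space N)) : S !=set0 ->
  orbital_set f C S =
    \bigcup_n \bigcup_(s in code_prefix n @` S) (word_map f s @` C).
Proof.
move=> [w0 Sw0]; apply/seteqP; split=> [y [Cy|[s [n _ ns] sy]]|].
- by exists 0%N => //; exists [::]; [exists w0|exists y].
- by exists n => //; exists s.
- move=> y [[|n] _ [s ns sy]]; last by right; exists s => //; exists n.+1.
  by left; move: ns sy => [w _ <-] [z Cz <-].
Qed.

(** Removing the first letter of a prefix of [w] leaves a prefix of the shifted sequence, again in
    [S]. *)
Lemma orbital_set_sub (X : Type) (N : nat) (f : 'I_N -> X -> X) (C : set X)
    (S : set (code_space N)) : shift_closed S ->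
  orbital_set f C S `<=` \bigcup_i (f i @` orbital_set f C S) `|` C.
Proof.
move=> Ssh y [Cy|[_ [[|n] // _ [w Sw <-]] [c Cc <-]]]; [by right|left].
have -> : code_prefix n.+1 w = w 0%N :: code_prefix n (Defs.shift w).
  by rewrite /code_prefix /mkseq /= -[1%N]addn0 iotaDl -map_comp.
exists (w 0%N) => //; exists (word_map f (code_prefix n (Defs.shift w)) c) => //.
(* The description by levels also covers [n = 0], where the remaining word is empty and the inner
   point is [c]. *)
rewrite orbital_setE; last by exists w.
exists n => //; exists (code_prefix n (Defs.shift w)); last by exists c.
by exists (Defs.shift w) => //; exact: Ssh.
Qed.

Unset Implicit Arguments.

Theorem theorem3p5 (R : realType) (X : completeMetricType R) (N : nat)
    (rho : 'I_N -> R) (f : 'I_N -> X -> X) (x : X)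
    (E C : set X) (S : set (code_space N)) :
  similarity_IFS rho f ->
  SSS f E ->
  compact S -> shift_closed S -> coding_map f x @` S = E ->
  C !=set0 -> compact C ->
  ISSS f C (E `|` orbital_set f C S).
Proof.
move=> f_sim [[e0 Ee0] cE Esub] _ Ssh ES _ cC; split.
- by exists e0; left.
- have S0 : S !=set0 by move: Ee0; rewrite -ES => -[w Sw _]; exists w.
  rewrite orbital_setE//; apply: compact_setU_bigcup_shrinking => // [n|e e_gt0].
    exact: compact_words_image.
  have [r r_itv rho_r] := IFS_ratio_bound f_sim.
  have [B fB] := coding_map_dist x f_sim r_itv rho_r.
  have [M M0 CM] := compact_mdist_bounded x cC.
  have /andP[r0 _] := r_itv.
  near=> n => _ [_ [w Sw <-] [c Cc <-]].
  (* Going through the image of [x] under the prefix map costs [r ^+ n * B] to reach the coded point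
     and [r ^+ n * M] to reach the image of [c], with [B] and [M] independent of [w] and [c]. *)
  exists (coding_map f x w); first by rewrite -ES; exists w.
  rewrite ballEmdist /=; apply: (@le_lt_trans _ _ (r ^+ n * (B + M))).
    rewrite mulrDr.
    apply: (le_trans (metric_triangle _ (word_map f (code_prefix n w) x) _)).
    rewrite lerD//.
    apply: (le_trans (word_map_lipschitz f_sim r_itv rho_r _ _ _)).
    by rewrite size_mkseq ler_wpM2l ?exprn_ge0 ?CM.
  by near: n; exact: geometric_lt_near.
- move=> y [/Esub[i _ [z Ez <-]]|
      /(@orbital_set_sub _ _ f C S Ssh)[|Cy]].
  + by left; exists i => //; exists z => //; left.
  + by move=> [i _ [z Oz <-]]; left; exists i => //; exists z => //; right.
  + by right.
Unshelve. all: by end_near. Qed.
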